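(* For all partitions $\lambda$ and $\mu$, the Heisenberg product in the basis of power sums can be expressed as $$p_\lambda\#p_\mu=\sum_{\substack{\alpha\gamma=\lambda\\ \gamma\beta=\mu}}z(\gamma)\,p_{\alpha\gamma\beta},$$ where the sum runs over all ways of decomposing $\lambda$ as $\alpha\gamma$ and $\mu$ as $\gamma\beta$ with a common partition $\gamma$ (decompositions counted with multiplicity), and $z(\gamma)=\prod_r r^{m_r}m_r!$, $m_r$ being the number of times $r$ occurs in $\gamma$ (that is, $z(\gamma)$ is the order of the stabilizer under conjugation, i.e. centralizer, of a permutation of cycle-type $\gamma$).
   Context: Let $\Bbbk$ be a field of characteristic zero and $\Lambda=\bigoplus_{n\ge0}\Lambda_n$ the graded space of symmetric functions over $\Bbbk$; $p_\lambda=p_{\lambda_1}p_{\lambda_2}\cdots$ are the power sums and $h_\alpha=h_{a_1}\cdots h_{a_r}$ the complete homogeneous symmetric functions. For partitions $\lambda,\mu$, $\lambda\mu$ denotes the partition obtained by concatenating and reordering the parts of $\lambda$ and $\mu$ (e.g. $(3,2,1,1)(2,2,1)=(3,2,2,2,1,1,1)$). Multiplicity convention: if $\lambda=(\lambda_1,\dots,\lambda_k)$ and $\mu=(\mu_1,\dots,\mu_l)$, the sum is over all pairs $(I,J)$, $I\subseteq\{1,\dots,k\}$, $J\subseteq\{1,\dots,l\}$, such that the multisets $\{\lambda_i\}_{i\in I}$ and $\{\mu_j\}_{j\in J}$ coincide; $\gamma$ is the partition given by this common multiset, $\alpha$ the partition with parts $\lambda_i$, $i\notin I$, and $\beta$ the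 partition with parts $\mu_j$, $j\notin J$. The Heisenberg product $\#$ on $\Lambda$ is the bilinear product induced, via Grothendieck groups and the Frobenius characteristic, by the operation $V\#W=\bigoplus_{n=\max(p,q)}^{p+q}\mathrm{Ind}_{S_p\times_nS_q}^{S_n}\mathrm{Res}^{S_p\times S_q}_{S_p\times_nS_q}(V\otimes W)$ for $V\in\mathrm{Rep}(S_p)$, $W\in\mathrm{Rep}(S_q)$, where $S_p\times_nS_q=S_{n-q}\times S_{p+q-n}\times S_{n-p}$ is embedded in $S_n$ in the standard parabolic way and in $S_p\times S_q$ by $(\sigma,\rho,\tau)\mapsto(\sigma\times\rho,\rho\times\tau)$. Explicitly, for compositions $\alpha=(a_1,\dots,a_r)$ of $p$ and $\beta=(b_1,\dots,b_s)$ of $q$, $$h_\alpha\#h_\beta=\sum_{n=\max(p,q)}^{p+q}\sum_{M\in\mathcal M^n_{\alpha,\beta}}h_{p(M)},$$ where $\mathcal M^n_{\alpha,\beta}$ is the set of matrices $(m_{ij})_{0\le i\le s,0\le j\le r}$ of non-negative integers with $m_{00}=0$, column sums $(n-p,a_1,\dots,a_r)$ and row sums $(n-q,b_1,\dots,b_s)$, and $p(M)$ is the partition formed by the non-zero entries of $M$. *)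

(* Defs.v *)
From HB Require Import structures.
From mathcomp Require Import all_boot all_order all_fingroup all_algebra.
From mathcomp Require Import mxrepresentation character.
From mathcomp Require Import boolp.
From mathcomp Require Import mpoly.

Set Implicit Arguments.
Unset Strict Implicit.
Unset Printing Implicit Defensive.

Import GRing.Theory.
Local Open Scope ring_scope.

(* Symmetric functions, as the inverse limit of the rings of symmetric
   polynomials in n variables along the maps x_n |-> 0, taken in the category
   of graded rings: whence the bound, uniform in n, on the degrees. *)

Section SymFun.
Variable k : comNzRingType.

Definition drop_last_var n (f : {mpoly k[n.+1]}) : {mpoly k[n]} :=
  f \mPo [tuple if unlift ord_max i is Some j then 'X_j else 0 | i < n.+1].

Record symfun : Type := SymFun {
  symfun_val :> forall n, {mpoly k[n]};
  symfun_sym : forall n, symfun_val n \is symmetric;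
  symfun_compat : forall n, drop_last_var (symfun_val n.+1) = symfun_val n;
  symfun_bounded : exists d, forall n, (msize (symfun_val n) <= d)%N }.

Lemma symfunP (f g : symfun) : (forall n, f n = g n) -> f = g.
Proof.
case: f g => [f f1 f2 f3] [g g1 g2 g3] /= fg.
have {}fg : f = g by apply: functional_extensionality_dep.
by subst g; congr SymFun; apply: Prop_irrelevance.
Qed.

HB.instance Definition _ := gen_eqMixin symfun.
HB.instance Definition _ := gen_choiceMixin symfun.

Fact zero_bounded : exists d, forall n, (msize (0 : {mpoly k[n]}) <= d)%N.
Proof. by exists 0%N => n; rewrite msize0. Qed.

Definition symfun_zero := @SymFun (fun=> 0) (fun=> rpred0 _)
  (fun=> comp_mpoly0 _) zero_bounded.

Fact one_compat n : drop_last_var 1 = 1 :> {mpoly k[n]}.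
Proof. exact: comp_mpoly1. Qed.

Fact one_bounded : exists d, forall n, (msize (1 : {mpoly k[n]}) <= d)%N.
Proof. by exists 1%N => n; rewrite msize1. Qed.

Definition symfun_one := @SymFun (fun=> 1) (fun=> rpred1 _)
  one_compat one_bounded.

Section Ops.
Variables (f g : symfun) (c : k).

Fact add_sym n : f n + g n \is symmetric.
Proof. by rewrite rpredD ?symfun_sym. Qed.

Fact add_compat n : drop_last_var (f n.+1 + g n.+1) = f n + g n.
Proof. by rewrite /drop_last_var comp_mpolyD -(symfun_compat f n) -(symfun_compat g n). Qed.

Fact add_bounded : exists d, forall n, (msize (f n + g n) <= d)%N.
Proof.
have [[d fd] [e ge]] := (symfun_bounded f, symfun_bounded g).
exists (maxn d e) => n; apply: leq_trans (mmeasureD_le _ _ _) _.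
by rewrite geq_max !leq_max fd ge orbT.
Qed.

Definition symfun_add := SymFun add_sym add_compat add_bounded.

Fact opp_sym n : - f n \is symmetric.
Proof. by rewrite rpredN symfun_sym. Qed.

Fact opp_compat n : drop_last_var (- f n.+1) = - f n.
Proof. by rewrite /drop_last_var comp_mpolyN -(symfun_compat f n). Qed.

Fact opp_bounded : exists d, forall n, (msize (- f n) <= d)%N.
Proof.
by have [d fd] := symfun_bounded f; exists d => n; rewrite mmeasureN.
Qed.

Definition symfun_opp := SymFun opp_sym opp_compat opp_bounded.

Fact mul_sym n : f n * g n \is symmetric.
Proof. by rewrite rpredM ?symfun_sym. Qed.

Fact mul_compat n : drop_last_var (f n.+1 * g n.+1) = f n * g n.
Proof. by rewrite /drop_last_var rmorphM -(symfun_compat f n) -(symfun_compat g n). Qed.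

Fact mul_bounded : exists d, forall n, (msize (f n * g n) <= d)%N.
Proof.
have [[d fd] [e ge]] := (symfun_bounded f, symfun_bounded g).
exists (d + e).+1%N => n; apply: leq_trans (msizeM_le _ _) _.
by rewrite ltnS leq_add.
Qed.

Definition symfun_mul := SymFun mul_sym mul_compat mul_bounded.

Fact scale_sym n : c *: f n \is symmetric.
Proof. by rewrite rpredZ ?symfun_sym. Qed.

Fact scale_compat n : drop_last_var (c *: f n.+1) = c *: f n.
Proof. by rewrite /drop_last_var comp_mpolyZ -(symfun_compat f n). Qed.

Fact scale_bounded : exists d, forall n, (msize (c *: f n) <= d)%N.
Proof.
have [d fd] := symfun_bounded f; exists d => n.
exact: leq_trans (msizeZ_le _ _) (fd n).
Qed.

Definition symfun_scale := SymFun scale_sym scale_compat scale_bounded.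

End Ops.

Fact symfun_addA : associative symfun_add.
Proof. by move=> f g h; apply: symfunP => n; apply: addrA. Qed.
Fact symfun_addC : commutative symfun_add.
Proof. by move=> f g; apply: symfunP => n; apply: addrC. Qed.
Fact symfun_add0 : left_id symfun_zero symfun_add.
Proof. by move=> f; apply: symfunP => n; apply: add0r. Qed.
Fact symfun_addN : left_inverse symfun_zero symfun_opp symfun_add.
Proof. by move=> f; apply: symfunP => n; apply: addNr. Qed.
HB.instance Definition _ := GRing.isZmodule.Build symfun
  symfun_addA symfun_addC symfun_add0 symfun_addN.

Fact symfun_mulA : associative symfun_mul.
Proof. by move=> f g h; apply: symfunP => n; apply: mulrA. Qed.
Fact symfun_mulC : commutative symfun_mul.
Proof. by move=> f g; apply: symfunP => n; apply: mulrC. Qed.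
Fact symfun_mul1 : left_id symfun_one symfun_mul.
Proof. by move=> f; apply: symfunP => n; apply: mul1r. Qed.
Fact symfun_mulDl : left_distributive symfun_mul +%R.
Proof. by move=> f g h; apply: symfunP => n; apply: mulrDl. Qed.
Fact symfun_1_neq0 : symfun_one != 0.
Proof.
apply/eqP => /(congr1 (fun f : symfun => f 0%N)) /eqP.
by rewrite /= oner_eq0.
Qed.
HB.instance Definition _ := GRing.Zmodule_isComNzRing.Build symfun
  symfun_mulA symfun_mulC symfun_mul1 symfun_mulDl symfun_1_neq0.

Fact symfun_scaleA a b f :
  symfun_scale (symfun_scale f b) a = symfun_scale f (a * b).
Proof. by apply: symfunP => n; apply: scalerA. Qed.
Fact symfun_scale1 f : symfun_scale f 1 = f.
Proof. by apply: symfunP => n; apply: scale1r. Qed.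
Fact symfun_scaleDr a :
  {morph (fun f => symfun_scale f a) : f g / f + g >-> f + g}.
Proof. by move=> f g; apply: symfunP => n; apply: scalerDr. Qed.
Fact symfun_scaleDl f : {morph symfun_scale f : a b / a + b >-> a + b}.
Proof. by move=> a b; apply: symfunP => n; apply: scalerDl. Qed.
HB.instance Definition _ := GRing.Zmodule_isLmodule.Build k symfun
  symfun_scaleA symfun_scale1 symfun_scaleDr symfun_scaleDl.

Fact symfun_scaleAl (a : k) (f g : symfun) : a *: (f * g) = a *: f * g.
Proof. by apply: symfunP => n; apply: scalerAl. Qed.
HB.instance Definition _ := GRing.Lmodule_isLalgebra.Build k symfun
  symfun_scaleAl.
HB.instance Definition _ := GRing.Lalgebra_isComAlgebra.Build k symfun.

Section PowerSum.
Variable r : nat.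

Fact powersum_sym n : \sum_(i < n) 'X_i ^+ r.+1 \is @symmetric n k.
Proof.
apply/issymP => s; rewrite raddf_sum /= [RHS](reindex_inj (@perm_inj _ s)) /=.
apply: eq_bigr => i _; rewrite rmorphXn /=; congr (_ ^+ _).
by rewrite /msym mmapX mmap1U.
Qed.

Fact powersum_compat n : drop_last_var (\sum_(i < n.+1) 'X_i ^+ r.+1) =
  \sum_(i < n) 'X_i ^+ r.+1 :> {mpoly k[n]}.
Proof.
rewrite /drop_last_var raddf_sum big_ord_recr /= rmorphXn /= comp_mpolyXU.
rewrite -tnth_nth tnth_mktuple unlift_none expr0n addr0.
apply: eq_bigr => i _; rewrite rmorphXn /= comp_mpolyXU -tnth_nth tnth_mktuple.
have -> : widen_ord (leqnSn n) i = lift ord_max i.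
  by apply: val_inj; rewrite /= /bump leqNgt ltn_ord.
by rewrite liftK.
Qed.

Fact powersum_bounded : exists d, forall n,
  (msize (\sum_(i < n) 'X_i ^+ r.+1 : {mpoly k[n]}) <= d)%N.
Proof.
exists r.+2 => n; apply: leq_trans (mmeasure_sum _ _ _ _) _.
apply/bigmax_leqP => i _.
by rewrite mpolyXn mmeasureX /= mdegMn mdeg1 mul1n.
Qed.

End PowerSum.

(* p_r = sum_i x_i^r for r > 0, and p_0 = 1 by convention. *)
Definition powersum (r : nat) : symfun :=
  if r is r'.+1 then
    SymFun (powersum_sym r') (powersum_compat r') (powersum_bounded r')
  else 1.

Definition powersums (la : seq nat) : symfun := \prod_(r <- la) powersum r.

End SymFun.

Definition is_partition (la : seq nat) : bool :=
  sorted geq la && (0%N \notin la).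

Definition partition_cat (la mu : seq nat) : seq nat := sort geq (la ++ mu).

(* enum I is increasing, so that a subpart of a partition is a partition. *)
Definition subpart (la : seq nat) (I : {set 'I_(size la)}) : seq nat :=
  [seq nth 0%N la i | i : 'I_(size la) <- enum I].
Arguments subpart : clear implicits.

Definition zee (ga : seq nat) : nat :=
  (\prod_(r <- undup ga) (r ^ count_mem r ga * (count_mem r ga)`!))%N.

Section Frobenius.
Variable k : fieldType.

Definition cycle_type n (s : 'S_n) : seq nat :=
  sort geq [seq #|X| | X : {set 'I_n} <- enum (porbits s)].

Definition frobenius n d (rG : mx_representation k [set: 'S_n] d) : symfun k :=
  (n`!%:R)^-1 *: \sum_(s : 'S_n) \tr (rG s) *: powersums k (cycle_type s).

End Frobenius.

Section Pullback.
Variables (k : fieldType) (aT rT : finGroupType).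
Variables (f : {morphism [set: aT] >-> rT}) (d : nat).
Variable (rG : mx_representation k [set: rT] d).

Fact pullback_subproof : [set: aT] \subset (f @*^-1 [set: rT])%g.
Proof. by apply/subsetP => x _; rewrite !inE. Qed.

Definition pullback_repr : mx_representation k [set: aT] d :=
  subg_repr (morphpre_repr f rG) pullback_subproof.

End Pullback.

(* The representations act on row vectors from the right, so the induced module
   is the direct sum of the V (x) t over representatives t of the right cosets
   of H, with (v (x) t) g = v (t g t'^-1) (x) t' if t g \in H t'. *)
Section Induced.
Variables (k : fieldType) (gT : finGroupType) (G H : {group gT}).
Hypothesis sHG : H \subset G.
Variables (d : nat) (rH : mx_representation k H d).

Definition coset_rep (i : 'I_#|rcosets H G|) : gT :=
  repr (enum_val i : {set gT}).

Definition extend0 (x : gT) : 'M[k]_d := if x \in H then rH x else 0.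

Definition induced_mx (g : gT) : 'M[k]_(\sum_(i < #|rcosets H G|) d) :=
  \mxblock_(i, j) extend0 (coset_rep i * g * (coset_rep j)^-1)%g.

Lemma rcoset_coset_rep i : enum_val i = (H :* coset_rep i)%g.
Proof.
have /rcosetsP[x _ def_i] := enum_valP i.
by rewrite /coset_rep def_i rcoset_repr.
Qed.

Lemma coset_repG i : coset_rep i \in G.
Proof.
have /rcosetsP[x Gx def_i] := enum_valP i.
have : coset_rep i \in (H :* x)%g.
  by rewrite /coset_rep def_i mem_repr_rcoset.
by case/rcosetP => h Hh ->; rewrite groupM //; apply: (subsetP sHG).
Qed.

Lemma coset_rep_inj i j :
  (coset_rep i * (coset_rep j)^-1 \in H)%g = (i == j).
Proof.
rewrite -mem_rcoset; apply/idP/eqP => [|->]; last exact: rcoset_refl.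
by move/rcoset_eqP => e; apply: enum_val_inj; rewrite !rcoset_coset_rep.
Qed.

Lemma ex_coset_rep x : x \in G -> exists i, (x * (coset_rep i)^-1 \in H)%g.
Proof.
move=> Gx; have Hx : (H :* x)%g \in rcosets H G by apply/rcosetsP; exists x.
exists (enum_rank_in Hx (H :* x)%g); rewrite -mem_rcoset -rcoset_coset_rep.
by rewrite enum_rankK_in ?rcoset_refl.
Qed.

Fact induced_mx_repr : mx_repr G induced_mx.
Proof.
split=> [|x y Gx Gy].
  rewrite -(mxdiagZ 1) /mxdiag; apply: eq_mxblock => i j.
  rewrite mulg1 /extend0 coset_rep_inj; case: eqP => [->|_] //=.
  by rewrite conform_mx_id mulgV repr_mx1.
rewrite /induced_mx mul_mxblock; apply: eq_mxblock => i j.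
have [l Hl] := ex_coset_rep (groupM (coset_repG i) Gx).
rewrite (bigD1 l) //= big1 ?addr0 => [|l' l'l].
  rewrite {2}/extend0 Hl.
  have -> : (coset_rep i * (x * y) * (coset_rep j)^-1 =
    (coset_rep i * x * (coset_rep l)^-1) *
      (coset_rep l * y * (coset_rep j)^-1))%g by rewrite !mulgA mulgKV.
  rewrite /extend0 groupMl //; case: ifP => [Hy|_]; last by rewrite mulmx0.
  by rewrite repr_mxM.
rewrite {1}/extend0 ifN ?mul0mx //; apply: contraNN l'l => Hl'.
rewrite eq_sym -coset_rep_inj.
move: Hl Hl'; set a := (coset_rep i * x)%g => /groupVr Hl /(groupM Hl).
by rewrite invMg invgK -mulgA mulKg.
Qed.

Definition induced_repr := MxRepresentation induced_mx_repr.

End Induced.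

Section InducedInj.
Variables (k : fieldType) (aT rT : finGroupType).
Variables (f : {morphism [set: aT] >-> rT}) (injf : ('injm f)%g) (d : nat).
Variable (rG : mx_representation k [set: aT] d).

Fact image_subproof :
  (f @* [set: aT])%g \subset (invm injf @*^-1 [set: aT])%g.
Proof. by rewrite morphpre_invm. Qed.

Definition image_repr : mx_representation k (f @* [set: aT])%G d :=
  subg_repr (morphpre_repr (invm_morphism injf) rG) image_subproof.

Definition induced_inj_repr :=
  induced_repr (subsetT (f @* [set: aT])%G) image_repr.

End InducedInj.

Section PermSum.
Variables a b : nat.

Definition perm_sum_fun (u : 'S_a * 'S_b) (i : 'I_(a + b)) : 'I_(a + b) :=
  match split i with
  | inl j => lshift b (u.1 j)
  | inr j => rshift a (u.2 j)
  end.

Fact perm_sum_inj u : injective (perm_sum_fun u).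
Proof.
apply: (@can_inj _ _ _ (perm_sum_fun (u.1^-1, u.2^-1)%g)) => i.
rewrite /perm_sum_fun; case: (split_ordP i) => j -> /=.
  by rewrite (unsplitK (inl _)) permK.
by rewrite (unsplitK (inr _)) permK.
Qed.

Definition perm_sum (u : 'S_a * 'S_b) : 'S_(a + b) := perm (@perm_sum_inj u).

Lemma perm_sumM (u v : 'S_a * 'S_b) :
  perm_sum (u * v)%g = (perm_sum u * perm_sum v)%g.
Proof.
apply/permP => i; rewrite permM !permE /perm_sum_fun.
by case: (split i) => j; rewrite ?(unsplitK (inl _)) ?(unsplitK (inr _)) permM.
Qed.

Lemma perm_sum_injective : injective perm_sum.
Proof.
move=> [u1 u2] [v1 v2] /permP e; congr (_, _); apply/permP => i.
  have := e (lshift b i).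
  by rewrite !permE /perm_sum_fun !(unsplitK (inl _)) => /lshift_inj.
have := e (rshift a i).
by rewrite !permE /perm_sum_fun !(unsplitK (inr _)) => /rshift_inj.
Qed.

End PermSum.

(* S_a x S_b x S_c, as a subgroup of S_n for n = a + b + c and mapped to
   S_p x S_q for p = a + b and q = b + c. *)
Section Embeddings.
Variables (a b c p q n : nat).
Hypotheses (ab : (a + b)%N = p) (bc : (b + c)%N = q) (abc : (a + b + c)%N = n).
Let gT : finGroupType := ('S_a * 'S_b * 'S_c)%type.

Definition to_Sp (u : gT) : 'S_p := cast_perm ab (perm_sum u.1).
Definition to_Sq (u : gT) : 'S_q := cast_perm bc (perm_sum (u.1.2, u.2)).
Definition to_Sn (u : gT) : 'S_n :=
  cast_perm abc (perm_sum (perm_sum u.1, u.2)).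

Fact to_SpM : {in [set: gT] &, {morph to_Sp : u v / (u * v)%g}}.
Proof. by move=> u v _ _; rewrite -cast_perm_morphM -perm_sumM. Qed.
Fact to_SqM : {in [set: gT] &, {morph to_Sq : u v / (u * v)%g}}.
Proof. by move=> u v _ _; rewrite -cast_perm_morphM -perm_sumM. Qed.
Fact to_SnM : {in [set: gT] &, {morph to_Sn : u v / (u * v)%g}}.
Proof.
move=> u v _ _; rewrite /to_Sn -cast_perm_morphM -perm_sumM.
by congr (cast_perm _ (perm_sum (_, _))); apply: perm_sumM.
Qed.

Canonical to_Sp_morphism := Morphism to_SpM.
Canonical to_Sq_morphism := Morphism to_SqM.
Canonical to_Sn_morphism := Morphism to_SnM.

Fact to_Sn_injm : ('injm to_Sn)%g.
Proof.
apply/injmP => -[u1 u2] [v1 v2] _ _ /cast_perm_inj/perm_sum_injective[].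
by move=> /perm_sum_injective -> ->.
Qed.

Variables (k : fieldType) (d e : nat).
Variable (V : mx_representation k [set: 'S_p] d).
Variable (W : mx_representation k [set: 'S_q] e).

(* Ind Res (V (x) W), inducing along to_Sn and restricting along
   u |-> (to_Sp u, to_Sq u) : S_p x S_q. *)
Definition ind_res_repr :=
  induced_inj_repr to_Sn_injm
    (prod_repr (pullback_repr to_Sp_morphism V)
               (pullback_repr to_Sq_morphism W)).

End Embeddings.

Section HeisenbergProduct.
Variable k : fieldType.

Definition heis_degree (p q : nat) : finType :=
  {n : 'I_(p + q).+1 | (maxn p q <= n)%N}.

Section Component.
Variables (p q : nat) (n : heis_degree p q).

Fact heis_degree_p : (val n - q + (p + q - val n))%N = p.
Proof.
case: n => -[m /= lem]; rewrite geq_max => /andP[? ?].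
by rewrite addnC addnBA // subnK // addnK.
Qed.

Fact heis_degree_q : (p + q - val n + (val n - p))%N = q.
Proof.
case: n => -[m /= lem]; rewrite geq_max => /andP[? ?].
by rewrite addnC addnBAC // subnKC // addKn.
Qed.

Fact heis_degree_n : (val n - q + (p + q - val n) + (val n - p))%N = val n.
Proof.
rewrite heis_degree_p; case: n => -[m /= lem].
by rewrite geq_max => /andP[? ?]; rewrite subnKC.
Qed.

Variables (d e : nat).
Variable (V : mx_representation k [set: 'S_p] d).
Variable (W : mx_representation k [set: 'S_q] e).

Definition heis_component :=
  ind_res_repr heis_degree_p heis_degree_q heis_degree_n V W.

End Component.

(* The Frobenius characteristic identifies k (x) (+)_n K_0(Rep S_n) with the
   space of symmetric functions, so these clauses determine the product. *)
Record is_heisenberg_product (op : symfun k -> symfun k -> symfun k) : Prop := {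
  heis_linearl : forall g, linear (op^~ g);
  heis_linearr : forall f, linear (op f);
  heis_frobenius : forall p q d e
    (V : mx_representation k [set: 'S_p] d)
    (W : mx_representation k [set: 'S_q] e),
    op (frobenius V) (frobenius W) =
      \sum_(n : heis_degree p q) frobenius (heis_component n V W) }.

End HeisenbergProduct.

(* Main.v *)
Require Import Defs.
From mathcomp Require Import all_boot all_fingroup all_algebra.
From mathcomp Require Import cyclic mxrepresentation character ring zify.

(* The product is only prescribed on Frobenius characteristics of
   representations. By an Artin-type induction theorem, every function on a
   finite group whose value at x depends only on the conjugacy class of the
   subgroup <[x]> is a linear combination of the characters induced from the
   trivial characters of cyclic subgroups; in a symmetric group this covers
   z_la times the indicator of the permutations of cycle type la, whose
   characteristic is p_la. By the formula for induced characters, the product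
   of the characteristics of X and Y is the sum over n of
     1 / (a! b! c!) sum_(u, v, w) X(u x v) Y(v x w) p_u p_v p_w
   with u, v, w in S_a, S_b, S_c. For the indicators above this is evaluated
   with the count n! / z_la of the permutations of cycle type la, and with
   z_la / (z_al z_ga) being the number of subsets of the parts of la that form
   ga and leave al. *)

Set Implicit Arguments.
Unset Strict Implicit.
Unset Printing Implicit Defensive.

Import GRing.Theory.
Local Open Scope ring_scope.

(** * Traces of induced representations summed against class functions *)

Section InducedTrace.
Variables (k : fieldType) (gT : finGroupType) (G H : {group gT}).
Hypothesis sHG : H \subset G.
Variables (d : nat) (rH : mx_representation k H d).

Lemma mxtrace_induced g : \tr (induced_mx G rH g) =
  \sum_(i < #|rcosets H G|)
     \tr (extend0 rH (g ^ (coset_rep i)^-1)%g).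
Proof.
rewrite /induced_mx mxtrace_mxblock; apply: eq_bigr => i _.
by rewrite /conjg invgK mulgA.
Qed.

(** Frobenius reciprocity without division. Conjugation by a coset representative turns each summand
    of the induced trace into the same sum over [H], since [extend0] vanishes off [H] and [f] is
    invariant. *)
Lemma sum_mxtrace_induced (V : lmodType k) (f : gT -> V) :
    {in G &, forall x g, f (x ^ g)%g = f x} ->
  \sum_(g in G) \tr (induced_repr sHG rH g) *: f g =
    #|G : H|%g%:R *: \sum_(h in H) \tr (rH h) *: f h.
Proof.
move=> fJ; under eq_bigr do rewrite /= mxtrace_induced scaler_suml.
rewrite exchange_big /=.
transitivity (\sum_(i < #|rcosets H G|) \sum_(h in H) \tr (rH h) *: f h).
  apply: eq_bigr => i _; have Gi := coset_repG sHG i.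
  rewrite (reindex_inj (conjg_inj (coset_rep i))) /=.
  rewrite (eq_bigl (mem G)) => [|g]; last by rewrite /= groupJr.
  rewrite (big_setID H) /= (setIidPr sHG) [X in _ + X]big1 => [|g].
    rewrite addr0; apply: eq_bigr => h Hh.
    by rewrite conjgK /extend0 Hh fJ // (subsetP sHG).
  by rewrite inE conjgK /extend0 => /andP[/negPf-> _]; rewrite linear0 scale0r.
by rewrite sumr_const card_ord scaler_nat.
Qed.

End InducedTrace.

(** By Lagrange the index of the image is the quotient of [#|rT|] by [#|aT|]; both orders stay as
    factors, so that nothing is divided. *)
Lemma sum_mxtrace_induced_inj (k : fieldType) (aT rT : finGroupType)
    (f : {morphism [set: aT] >-> rT}) (injf : ('injm f)%g) (d : nat)
    (rG : mx_representation k [set: aT] d) (V : lmodType k) (F : rT -> V) :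
    (forall x g, F (x ^ g)%g = F x) ->
  #|aT|%:R *: (\sum_(g : rT) \tr (induced_inj_repr injf rG g) *: F g) =
  #|rT|%:R *: (\sum_(u : aT) \tr (rG u) *: F (f u)).
Proof.
move=> FJ; have := sum_mxtrace_induced (subsetT (f @* [set: aT])%G)
  (image_repr injf rG) (fun x g _ _ => FJ x g).
rewrite (eq_bigl xpredT) => [->|g]; last by rewrite inE.
rewrite scalerA -natrM -!cardsT -{1}(card_injm injf (subxx _)).
rewrite Lagrange ?subsetT //; congr (_ *: _).
rewrite (eq_bigl [in f @: [set: aT]]) => [|g]; last by rewrite -morphimEdom.
rewrite big_imset /=; last exact/injmP.
rewrite (eq_bigl xpredT) => [|g]; last by rewrite inE.
by apply: eq_bigr => u _; rewrite invmE // inE.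
Qed.

(** * Artin-type induction from cyclic subgroups *)

Section CyclicSpan.
Variables (k : fieldType) (gT : finGroupType).
Hypothesis char_k : [pchar k] =i pred0.

Definition trivial_mx (x : gT) : 'M[k]_1 := 1%:M.

Lemma trivial_mx_repr (H : {group gT}) : mx_repr H trivial_mx.
Proof. by split=> // x y _ _; rewrite /trivial_mx mulmx1. Qed.

(** The character of the permutation representation on the right cosets of [H]. *)
Definition perm_character (H : {group gT}) (y : gT) : k :=
  \tr (induced_repr (subsetT H) (MxRepresentation (trivial_mx_repr H)) y).

Lemma natr_neq0 n : (0 < n)%N -> n%:R != 0 :> k.
Proof. by move=> n_gt0; rewrite (proj1 (pcharf0P _) char_k) -lt0n. Qed.

Lemma sum_coset_rep (G H : {group gT}) (f : gT -> nat) : H \subset G ->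
    {in H & G, forall h x, f (h * x)%g = f x} ->
  (\sum_(x in G) f x = #|H| * \sum_(i < #|rcosets H G|) f (coset_rep i))%N.
Proof.
move=> sHG fM; have tiP := rcosets_partition sHG.
rewrite -{1}(cover_partition tiP) big_trivIset ?(partition_trivIset tiP) //=.
rewrite big_enum_val big_distrr /=; apply: eq_bigr => i _.
rewrite (rcoset_coset_rep i) -(card_rcoset H (coset_rep i)) -sum_nat_const.
apply: eq_bigr => _ /rcosetP[h Hh ->]; apply: fM => //.
exact: (coset_repG sHG i).
Qed.

(** Whether the conjugate of [y] by the inverse of [t] lies in [H] depends only on the coset [H t],
    so the sum over representatives given by the trace is the count over the whole group divided by
    [#|H|]. *)
Lemma perm_characterE (H : {group gT}) y :
  perm_character H y = #|H|%:R^-1 * #|[set t | y ^ t \in H]%g|%:R.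
Proof.
have -> : #|[set t | y ^ t \in H]%g| = (\sum_(t in [set: gT]) (y ^ t^-1 \in H)%g)%N.
  rewrite (reindex_inj invg_inj) /= -sum1dep_card big_mkcond /=.
  apply: eq_big => [t|t _]; first by rewrite inE.
  by rewrite invgK; case: (_ \in _).
rewrite (sum_coset_rep (subsetT H)) => [|h x Hh _]; last first.
  by rewrite invMg conjgM memJ_norm // groupV (subsetP (normG H)).
rewrite natrM mulKf ?natr_neq0 // /perm_character mxtrace_induced natr_sum.
apply: eq_bigr => i _; rewrite /extend0; case: ifP => _ /=.
  by rewrite mxtrace1.
by rewrite mxtrace0.
Qed.

Lemma perm_character_eq0 (x y : gT) : (#[x]%g < #[y]%g)%N ->
  perm_character <[x]> y = 0.
Proof.
move=> lt_xy; rewrite perm_characterE.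
rewrite (_ : [set _ | _] = set0) ?cards0 ?mulr0 //.
apply/setP=> t; rewrite !inE; apply/negP => /order_dvdG.
by rewrite orderJ -orderE => /(dvdn_leq (order_gt0 x)); rewrite leqNgt lt_xy.
Qed.

(** Membership of [y ^ t] in [H] depends only on the subgroup generated by [y], and left translation
    by [g] matches the two sets of [t]. *)
Lemma perm_character_cycle (H : {group gT}) (x y g : gT) :
  <[y]>%g = (<[x]> :^ g)%g -> perm_character H y = perm_character H x.
Proof.
move=> eq_yx; rewrite !perm_characterE; congr (_ * _%:R).
rewrite -(card_lcoset [set t | y ^ t \in H]%g g); apply: eq_card => t.
rewrite mem_lcoset !inE -!cycle_subG !cycleJ eq_yx.
by rewrite -conjsgM mulKVg.
Qed.

Definition cyclic_class_fun (f : {ffun gT -> k}) :=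
  forall x y g, <[y]>%g = (<[x]> :^ g)%g -> f y = f x.

(** For [x] and [y] of equal order, [y ^ t] lies in [<[x]>] only if it generates it, and then
    [f x = f y]. After exchanging the sums, each [t] leaves [totient #[y]] generators [x]. With
    [perm_character_eq0] this gives a triangular system with respect to the order of elements. *)
Lemma sum_perm_character_cycle (f : {ffun gT -> k}) y : cyclic_class_fun f ->
  \sum_(x : gT | #[x]%g == #[y]%g) f x * perm_character <[x]> y =
    #|gT|%:R * (totient #[y]%g)%:R / #[y]%g%:R * f y.
Proof.
move=> f_cyc; transitivity
  (\sum_(x : gT | #[x]%g == #[y]%g)
     \sum_(t : gT | <[y ^ t]>%g == <[x]>%g) f y / #[y]%g%:R).
  apply: eq_bigr => x /eqP eq_xy; rewrite perm_characterE -orderE eq_xy.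
  set A := [set t | _].
  have eqA t : (t \in A) = (<[y ^ t]>%g == <[x]>%g).
    by rewrite inE -cycle_subG eqEcard -!orderE orderJ eq_xy leqnn andbT.
  under eq_bigl do rewrite -eqA.
  rewrite sumr_const mulr_natr mulrnAr.
  have [->|[t]] := set_0Vmem A; first by rewrite cards0 !mulr0n.
  rewrite eqA cycleJ => /eqP e.
  by rewrite (f_cyc _ _ t (esym e)).
rewrite (exchange_big_dep xpredT) //=.
transitivity (\sum_(t : gT) (totient #[y]%g)%:R * (f y / #[y]%g%:R)).
  apply: eq_bigr => t _; rewrite -(orderJ y t) totient_gen -sum1dep_card.
  rewrite natr_sum mulr_suml; apply: eq_big => [x|x _]; last by rewrite mul1r.
  rewrite /generator /order.
  by case: (<[y ^ t]>%g =P _) => [->|]; rewrite ?eqxx ?andbF.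
by rewrite sumr_const -mulr_natl -[#|xpredT|]/#|gT|; rewrite mulrA; ring.
Qed.

(** Induction on a bound beyond which [f] vanishes: on elements of order [m], [f] agrees with a
    combination [S] of characters induced from cyclic subgroups of order [m]. As [S] vanishes at
    larger orders, subtracting it lowers the bound. *)
Lemma cyclic_class_fun_ind (Q : {ffun gT -> k} -> Prop) :
    Q 0 -> (forall a f g, Q f -> Q g -> Q [ffun x => a * f x + g x]) ->
    (forall d (rG : mx_representation k [set: gT] d),
       Q [ffun x => \tr (rG x)]) ->
  forall f, cyclic_class_fun f -> Q f.
Proof.
move=> Q0 QD Qchar f f_cyc.
suff {f f_cyc}: forall m f, cyclic_class_fun f ->
    (forall y, (m <= #[y]%g)%N -> f y = 0) -> Q f.
  (* Orders of elements are at most [#|gT|], so the vanishing condition is vacuous at this bound. *)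
  move=> /(_ #|gT|.+1 f f_cyc); apply=> y.
  by rewrite ltnNge -cardsT dvdn_leq ?cardG_gt0 // order_dvdG ?inE.
elim=> [|m IHm] f f_cyc f0.
  by have -> : f = 0 by apply/ffunP => y; rewrite f0 // ffunE.
(* The inverse of the scalar in [sum_perm_character_cycle] for elements of order [m]. *)
pose c : k := m%:R / (#|gT|%:R * (totient m)%:R).
pose th x : {ffun gT -> k} := [ffun y => perm_character <[x]> y].
pose S := \sum_(x : gT | #[x]%g == m) [ffun y => c * f x * th x y].
have SE y : S y = \sum_(x : gT | #[x]%g == m) c * f x * perm_character <[x]> y.
  by rewrite sum_ffunE; apply: eq_bigr => x _; rewrite !ffunE.
have QS : Q S.
  rewrite /S; elim/big_rec: _ => // x g _ Qg.
  have -> : [ffun y => c * f x * th x y] + g =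
    [ffun y => c * f x * th x y + g y] by apply/ffunP => y; rewrite !ffunE.
  exact: QD (Qchar _ _) Qg.
have -> : f = [ffun x => 1 * [ffun y => f y - S y] x + S x].
  by apply/ffunP => y; rewrite !ffunE mul1r subrK.
apply: QD => //; apply: IHm => [x y g e|y].
  rewrite !ffunE (f_cyc _ _ _ e) !SE; congr (_ - _).
  by apply: eq_bigr => z _; rewrite (perm_character_cycle _ e).
rewrite leq_eqVlt => /predU1P[def_m | lt_my]; last first.
  rewrite ffunE f0 // SE big1 ?subr0 // => x /eqP ox.
  by rewrite perm_character_eq0 ?mulr0 // ox.
rewrite ffunE SE def_m.
under eq_bigr do rewrite -mulrA.
rewrite -mulr_sumr sum_perm_character_cycle // /c def_m.
have y0 : #[y]%g%:R != 0 :> k by rewrite natr_neq0.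
have t0 : (totient #[y]%g)%:R != 0 :> k by rewrite natr_neq0 ?totient_gt0.
have G0 : #|gT|%:R != 0 :> k by rewrite natr_neq0 // -cardsT cardG_gt0.
by field; rewrite y0 t0 G0.
Qed.
End CyclicSpan.

(** * Cycle types and the number of permutations of a given type *)

Section CycleType.
Local Open Scope nat_scope.

Lemma sum_card_porbit (T : finType) (s : {perm T}) (F : nat -> nat) :
  \sum_x F #|porbit s x| = \sum_(X in porbits s) #|X| * F #|X|.
Proof.
rewrite (partition_big_imset (porbit s)) /=.
apply: eq_bigr => _ /imsetP[y _ ->].
rewrite (eq_bigr (fun=> F #|porbit s y|)) => [|x /eqP-> //].
rewrite sum_nat_const; congr (_ * _).
by apply: eq_card => x; rewrite -eq_porbit_mem.
Qed.

(** An [r]-cycle has [r] points. Counting points instead of cycles lets cycle types be compared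
    through sums over the underlying set. *)
Lemma count_cycle_type n (s : 'S_n) r :
  r * count_mem r (cycle_type s) = \sum_i (#|porbit s i| == r).
Proof.
rewrite (sum_card_porbit s (fun c => c == r)).
rewrite (seq.permP (permEl (perm_sort _ _))) count_map -sum1_count big_enum_cond.
rewrite big_distrr /= big_mkcondr; apply: eq_bigr => X _ /=.
by case: eqP => [->|]; rewrite ?muln0.
Qed.

Lemma sumn_cycle_type n (s : 'S_n) : sumn (cycle_type s) = n.
Proof.
rewrite (perm_sumn (permEl (perm_sort _ _))) sumnE big_map big_enum /=.
rewrite -[RHS]card_ord -sum1_card (sum_card_porbit s (fun=> 1)).
by apply: eq_bigr => X _; rewrite muln1.
Qed.

Lemma cycle_type_gt0 n (s : 'S_n) : 0 \notin cycle_type s.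
Proof.
rewrite mem_sort; apply/mapP => -[X].
by rewrite mem_enum => /imsetP[x _ ->] /esym/eqP/negPn; rewrite card_porbit_neq0.
Qed.

Lemma eq_mul_count (l1 l2 : seq nat) : 0 \notin l1 -> 0 \notin l2 ->
  (forall r, r * count_mem r l1 = r * count_mem r l2) -> perm_eq l1 l2.
Proof.
move=> /count_memPn l1_0 /count_memPn l2_0 eq12; apply/allP => -[|r] _ /=.
  by rewrite l1_0 l2_0.
by have /eqP := eq12 r.+1; rewrite eqn_pmul2l.
Qed.

Lemma cycle_type_eq n (s : 'S_n) (l : seq nat) : 0 \notin l ->
  (forall r, \sum_i (#|porbit s i| == r) = r * count_mem r l) ->
  perm_eq (cycle_type s) l.
Proof.
move=> l0 eq_sl; apply: eq_mul_count => // [|r]; first exact: cycle_type_gt0.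
by rewrite count_cycle_type.
Qed.

Lemma porbit_step (T : finType) (s : {perm T}) x : porbit s (s x) = porbit s x.
Proof. exact: (porbit_perm s 1). Qed.

Lemma mem_porbit_step (T : finType) (s : {perm T}) x y :
  (s x \in porbit s y) = (x \in porbit s y).
Proof. by rewrite -!eq_porbit_mem porbit_step. Qed.

(** Intertwining is asked only along the orbit of [x], so that this applies to permutations that
    differ on another cycle. *)
Lemma porbit_morph (T U : finType) (f : T -> U) (s : {perm T}) (t : {perm U}) x :
  injective f -> {in porbit s x, {morph f : y / s y >-> t y}} ->
  porbit t (f x) = f @: porbit s x.
Proof.
move=> inj_f fM.
have ft i : f ((s ^+ i)%g x) = (t ^+ i)%g (f x).
  elim: i => [|i IHi]; first by rewrite !expg0 !perm1.
  by rewrite !expgSr !permM -IHi fM ?mem_porbit.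
apply/setP => u; apply/porbitP/imsetP => [[i ->]|[_ /porbitP[i ->] ->]].
  by exists ((s ^+ i)%g x); rewrite ?mem_porbit.
by exists i.
Qed.

Lemma card_porbit_morph (T U : finType) (f : T -> U) (s : {perm T}) (t : {perm U}) x :
  injective f -> {in porbit s x, {morph f : y / s y >-> t y}} ->
  #|porbit t (f x)| = #|porbit s x|.
Proof. by move=> inj_f fM; rewrite (porbit_morph inj_f fM) card_imset. Qed.

Lemma cycle_type_conj n (s g : 'S_n) : cycle_type (s ^ g)%g = cycle_type s.
Proof.
(* The order is total, transitive and antisymmetric, so equality of the sorted lists reduces to
   equality of multisets. *)
rewrite /cycle_type; apply/perm_sortP.
- by move=> x y; apply: leq_total.
- by move=> x y z /= yx xz; apply: leq_trans yx.
- by move=> x y; rewrite /= -eqn_leq eq_sym => /eqP.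
rewrite -(perm_sort geq) perm_sym -(perm_sort geq) perm_sym.
apply: cycle_type_eq (cycle_type_gt0 _) _ => // r.
rewrite count_cycle_type (reindex_perm g); apply: eq_bigr => i _.
rewrite (@card_porbit_morph _ _ g s) //; first exact: perm_inj.
by move=> y _; rewrite permJ.
Qed.

Lemma cycle_type_cycle n (s t : 'S_n) : <[s]>%g = <[t]>%g ->
  cycle_type s = cycle_type t.
Proof.
move=> eq_st; suff: porbits s = porbits t by rewrite /cycle_type => ->.
by apply: eq_imset => x; rewrite porbit.unlock eq_st.
Qed.

Lemma cycle_type_cast m n (e : m = n) (s : 'S_m) :
  cycle_type (cast_perm e s) = cycle_type s.
Proof. by case: n / e; rewrite cast_perm_id. Qed.

Lemma cycle_type_perm_sum a b (u : 'S_a * 'S_b) :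
  perm_eq (cycle_type (perm_sum u)) (cycle_type u.1 ++ cycle_type u.2).
Proof.
apply: cycle_type_eq => // [|r]; first by rewrite mem_cat negb_or !cycle_type_gt0.
rewrite big_split_ord count_cat mulnDr !count_cycle_type /=; congr (_ + _).
  apply: eq_bigr => i _; rewrite (@card_porbit_morph _ _ (@lshift a b) u.1) //.
    exact: lshift_inj.
  by move=> j _; rewrite permE /perm_sum_fun (unsplitK (inl _)).
apply: eq_bigr => i _; rewrite (@card_porbit_morph _ _ (@rshift a b) u.2) //.
  exact: rshift_inj.
by move=> j _; rewrite permE /perm_sum_fun (unsplitK (inr _)).
Qed.

Lemma zee_perm l1 l2 : perm_eq l1 l2 -> zee l1 = zee l2.
Proof.
move=> eq12; rewrite /zee (perm_big _ (perm_undup (perm_mem eq12))) /=.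
by apply: eq_bigr => r _; rewrite (seq.permP eq12).
Qed.

(** Raising the multiplicity of [r] from [m] to [m + 1] multiplies its factor by [r * (m + 1)] and
    leaves the other factors alone. *)
Lemma zee_cons r la : zee (r :: la) = r * (count_mem r la).+1 * zee la.
Proof.
have eq_rest (l : seq nat) : r \notin l ->
    \prod_(q <- l) (q ^ count_mem q (r :: la) * (count_mem q (r :: la))`!) =
    \prod_(q <- l) (q ^ count_mem q la * (count_mem q la)`!).
  move=> l_r; rewrite big_seq [RHS]big_seq; apply: eq_bigr => q lq /=.
  by rewrite (_ : (r == q) = false) //; apply: contraNF l_r => /eqP->.
rewrite /zee [undup (r :: la)]/=; case: ifP => [la_r | /negbT la_r].
  have u_la := undup_uniq la.
  have la_r' : r \in undup la by rewrite mem_undup.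
  rewrite (perm_big _ (perm_to_rem la_r')) [in RHS](perm_big _ (perm_to_rem la_r')).
  rewrite !big_cons eq_rest ?mem_rem_uniq ?inE ?eqxx //= eqxx add1n expnS factS.
  by lia.
rewrite big_cons eq_rest ?mem_undup //= eqxx add1n expnS factS.
by rewrite (count_memPn la_r) expn0 fact0 !muln1.
Qed.

(** * Inserting a new last point into a permutation *)

Lemma widen_ord_lift_max n (i : 'I_n) : widen_ord (leqnSn n) i = lift ord_max i.
Proof. by apply: ord_inj; rewrite lift_max. Qed.

(** The new point [ord_max] enters the cycle of [j] just before [j]; for [j = ord_max] it becomes a
    fixed point. *)
Definition insert_perm n (s : 'S_n) (j : 'I_n.+1) : 'S_n.+1 :=
  (lift_perm ord_max ord_max s * tperm ord_max j)%g.

Lemma insert_perm_bij n :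
  bijective (fun sj : 'S_n * 'I_n.+1 => insert_perm sj.1 sj.2).
Proof.
apply: inj_card_bij => [[s i] [t j]|]; last first.
  by rewrite card_prod card_ord !card_Sn factS mulnC.
rewrite /insert_perm /= => e; have ij : i = j.
  have := congr1 (fun u : 'S_n.+1 => u ord_max) e.
  by rewrite /= !permM !lift_perm_id !tpermL.
rewrite ij in e *; congr (_, _); apply/permP => x.
have := congr1 (fun u : 'S_n.+1 => u (lift ord_max x)) (mulIg _ _ _ e).
by rewrite /= !lift_perm_lift => /lift_inj.
Qed.

Lemma insert_perm_max n (s : 'S_n) j : insert_perm s j ord_max = j.
Proof. by rewrite permM lift_perm_id tpermL. Qed.

Lemma insert_perm_lift n (s : 'S_n) j x : insert_perm s j (lift ord_max x) =
  if lift ord_max (s x) == j then ord_max else lift ord_max (s x).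
Proof.
rewrite permM lift_perm_lift; case: eqP => [->|]; first by rewrite tpermR.
by move=> ne; rewrite tpermD ?neq_lift // eq_sym; apply/eqP.
Qed.

Lemma cycle_type_insert_max n (s : 'S_n) :
  perm_eq (cycle_type (insert_perm s ord_max)) (1 :: cycle_type s).
Proof.
apply: cycle_type_eq => [|r]; first by rewrite inE cycle_type_gt0.
rewrite big_ord_recr /= -/(count_mem r _) mulnDr count_cycle_type addnC.
congr (_ + _).
  rewrite (_ : porbit _ _ = [set ord_max]).
    by rewrite cards1; case: eqP => [<-|]; rewrite ?muln0.
  apply/setP => x; rewrite inE.
  apply/porbitP/eqP => [[i ->]|->]; last by exists 0; rewrite perm1.
  by elim: i => [|i IHi]; rewrite ?perm1 // expgSr permM IHi insert_perm_max.
apply: eq_bigr => i _; rewrite widen_ord_lift_max.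
rewrite (@card_porbit_morph _ _ (lift ord_max) s) //; first exact: lift_inj.
by move=> x _; rewrite insert_perm_lift eq_sym (negPf (neq_lift _ _)).
Qed.

Lemma porbit_insert_lift n (s : 'S_n) j :
  porbit (insert_perm s (lift ord_max j)) ord_max =
    ord_max |: (lift ord_max @: porbit s j).
Proof.
set t := insert_perm _ _.
have t_max : t ord_max = lift ord_max j by exact: insert_perm_max.
have t_lift x :
    t (lift ord_max x) = if s x == j then ord_max else lift ord_max (s x).
  by rewrite /t insert_perm_lift (inj_eq lift_inj).
apply/eqP; rewrite eqEsubset; apply/andP; split.
  apply/subsetP => _ /porbitP[i ->]; elim: i => [|i IHi].
    by rewrite perm1 setU11.
  rewrite expgSr permM; move: IHi => /setU1P[->|/imsetP[x jx ->]].
    by rewrite t_max setU1r ?imset_f ?porbit_id.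
  rewrite t_lift; case: ifP => _; first exact: setU11.
  by rewrite setU1r // imset_f // mem_porbit_step.
apply/subsetP => _ /setU1P[->|/imsetP[_ /porbitP[i ->] ->]]; first exact: porbit_id.
(* On the old points [t] departs from [s] only at the return to [j], which now passes through
   [ord_max]. *)
elim: i => [|i IHi]; first by rewrite perm1 -t_max mem_porbit_step porbit_id.
rewrite expgSr permM; have := t_lift ((s ^+ i)%g j); case: eqP => [->|_ <-].
  by rewrite -t_max mem_porbit_step porbit_id.
by rewrite mem_porbit_step.
Qed.

(* The cycle of j grows by one; stated with an extra part on both sides to avoid
   deleting a part. *)
Lemma cycle_type_insert_lift n (s : 'S_n) j :
  perm_eq (#|porbit s j| :: cycle_type (insert_perm s (lift ord_max j)))
          (#|porbit s j|.+1 :: cycle_type s).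
Proof.
set t := insert_perm _ _; set c := #|porbit s j|.
have t_lift x : x \notin porbit s j -> #|porbit t (lift ord_max x)| = #|porbit s x|.
  move=> jx; apply: card_porbit_morph => [|y xy]; first exact: lift_inj.
  rewrite /t insert_perm_lift (inj_eq lift_inj); case: eqP => // sy.
  by rewrite porbit_sym -sy mem_porbit_step xy in jx.
have t_max : #|porbit t ord_max| = c.+1.
  rewrite porbit_insert_lift cardsU1 card_imset; last exact: lift_inj.
  rewrite (_ : _ \notin _) //; apply/imsetP => -[x _ /eqP].
  by rewrite (negPf (neq_lift _ _)).
have t_in x : x \in porbit s j -> #|porbit t (lift ord_max x)| = c.+1.
  move=> jx; rewrite -t_max; congr #|pred_of_set _|; apply/eqP.
  by rewrite eq_porbit_mem porbit_insert_lift setU1r ?imset_f.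
have c_neq0 : c != 0 by exact: card_porbit_neq0.
apply: eq_mul_count => [||r];
  rewrite ?inE 1?eq_sym ?negb_or ?c_neq0 ?cycle_type_gt0 //=.
rewrite !mulnDr !count_cycle_type.
rewrite big_ord_recr /= t_max [\sum_(i < n) _](bigID [in porbit s j]) /=.
rewrite [\sum_(i < n) _](bigID [in porbit s j]) /=.
under eq_bigr => i ji do rewrite widen_ord_lift_max t_in //.
under [X in _ + X + _]eq_bigr => i ji do rewrite widen_ord_lift_max t_lift //.
under [X in _ = _ + (X + _)]eq_bigr => i ji.
  rewrite (_ : porbit s i = porbit s j); last by apply/eqP; rewrite eq_porbit_mem.
  over.
(* Points off the cycle of [j] give the same sum [X] on both sides. There remain [c + 1] points in a
   cycle of length [c + 1] on the left and [c] points in one of length [c] on the right, balanced by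
   the extra parts. *)
rewrite !sum_nat_const -/c; move: (\sum_(i < n | _) _) => X; clearbody c.
case: eqP => e1; case: eqP => e2; rewrite ?muln1 ?muln0 /=; clear -e1 e2; lia.
Qed.

Lemma sum_insert_perm n (F : 'S_n.+1 -> nat) :
  \sum_s F s = \sum_(s : 'S_n) (F (insert_perm s ord_max) +
    \sum_(j < n) F (insert_perm s (lift ord_max j))).
Proof.
rewrite (reindex _ (onW_bij _ (insert_perm_bij n))) /=.
rewrite -(pair_bigA _ (fun s j => F (insert_perm s j))); apply: eq_bigr => s _.
rewrite big_ord_recr addnC; congr (_ + _).
by apply: eq_bigr => j _; rewrite widen_ord_lift_max.
Qed.

(** No part exceeds the sum, so all parts fall within the range of summation; a part [q] is met at
    index [q - 1]. *)
Lemma sumn_count N (la : seq nat) : 0 \notin la -> sumn la <= N ->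
  \sum_(i < N) i.+1 * count_mem i.+1 la = sumn la.
Proof.
elim: la => [_ _|q la IHla] /=; first by rewrite big1 // => i; rewrite muln0.
rewrite inE negb_or eq_sym -lt0n => /andP[q_gt0 la0] leN.
under eq_bigr do rewrite mulnDr.
rewrite big_split IHla ?(leq_trans (leq_addl _ _) leN) //=; congr (_ + _).
have lt_qN : q.-1 < N by rewrite prednK // (leq_trans (leq_addr _ _) leN).
rewrite (bigD1 (Ordinal lt_qN)) //= prednK // eqxx muln1 big1 ?addn0 // => i.
rewrite -val_eqE /= -(inj_eq succn_inj) prednK // eq_sym => /negPf->.
by rewrite muln0.
Qed.

(* A permutation of n + 1 points of cycle type la arises by inserting the last
   point as a fixed point, or into an r-cycle, for each part r + 1 of la; by
   induction and the recursion for zee, the part r + 1 contributes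
   n! (r + 1) (count r+1 la) / zee la, and these numbers add up to
   n! (sumn la) / zee la. *)
Lemma card_cycle_type n (la : seq nat) : 0 \notin la -> sumn la = n ->
  (\sum_(s : 'S_n) perm_eq (cycle_type s) la) * zee la = n`!.
Proof.
elim: n la => [|n IHn] la la0 la_n.
  have nil_eq l : 0 \notin l -> sumn l = 0 -> l = [::].
    by case: l => [|[|x] l].
  rewrite (nil_eq la) // (eq_bigr (fun=> 1)) => [|s _]; last first.
    by rewrite (nil_eq (cycle_type s)) ?cycle_type_gt0 ?sumn_cycle_type.
  by rewrite sum_nat_const card_Sn /zee big_nil.
rewrite sum_insert_perm.
have lift_la (s : 'S_n) j :
  perm_eq (cycle_type (insert_perm s (lift ord_max j))) la =
    perm_eq (#|porbit s j| :: la) (#|porbit s j|.+1 :: cycle_type s).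
  rewrite -(perm_cons #|porbit s j|) perm_sym.
  by rewrite (permPr (cycle_type_insert_lift s j)).
(* The index 0 stands for a fixed new point. For [r > 0] the first factor is the number of points in
   [r]-cycles, and the test says that [la] is the type of [s] with one [r] replaced by [r + 1]. *)
pose D (s : 'S_n) r := if r is 0 then (perm_eq (1 :: cycle_type s) la : nat)
  else r * count_mem r (cycle_type s) * perm_eq (r :: la) (r.+1 :: cycle_type s).
have insertE s : perm_eq (cycle_type (insert_perm s ord_max)) la +
  \sum_(j < n) perm_eq (cycle_type (insert_perm s (lift ord_max j))) la =
  \sum_(r < n.+1) D s r.
  rewrite big_ord_recl (permPl (cycle_type_insert_max s)); congr (_ + _).
  have ltn_porbit j : #|porbit s j|.-1 < n.
    by rewrite prednK ?lt0n ?card_porbit_neq0 // -[X in _ <= X](card_ord n) max_card.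
  rewrite (partition_big (fun j => Ordinal (ltn_porbit j)) xpredT) //=.
  apply: eq_bigr => r _; rewrite count_cycle_type.
  rewrite big_distrl [RHS]big_mkcond [LHS]big_mkcond /=; apply: eq_bigr => j _.
  rewrite lift_la -val_eqE /= /bump leq0n add1n -(inj_eq succn_inj).
  rewrite prednK ?lt0n ?card_porbit_neq0 //.
  by case: eqP => [->|_]; rewrite ?mul1n.
rewrite (eq_bigr _ (fun s _ => insertE s)) exchange_big big_distrl /=.
have D_la r : (\sum_s D s r) * zee la = n`! * (r.+1 * count_mem r.+1 la).
  have [la_r|la_r] := boolP (r.+1 \in la); last first.
    rewrite (count_memPn la_r) !muln0 big1 // => s _; rewrite /D.
    have no l l' : r.+1 \notin l -> perm_eq l (r.+1 :: l') = false.
      by move=> lr; apply: contraNF lr => /perm_mem->; rewrite mem_head.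
    case: r la_r no => [|r] la_r no; first by rewrite perm_sym no.
    by rewrite no ?muln0 // inE negb_or neq_ltn ltnSn orbT.
  (* Before the insertion the type is [ka] if the removed part is 1, and otherwise [ka] together
     with that part lowered by one. *)
  have [ka la_ka] : exists ka, perm_eq la (r.+1 :: ka).
    by exists (rem r.+1 la); apply: perm_to_rem.
  have ka0 : 0 \notin ka by move: la0; rewrite (perm_mem la_ka) inE.
  have : sumn la = r.+1 + sumn ka by rewrite (perm_sumn la_ka).
  rewrite (zee_perm la_ka) (seq.permP la_ka) zee_cons /= eqxx add1n la_n => -[n_ka].
  case: r {la_r} la_ka n_ka => [|r] la_ka n_ka.
    under eq_bigr do rewrite /D (permPr la_ka) perm_cons.
    rewrite -(IHn ka) //. move: (\sum_s _) (zee _) (count_mem _ _) => X Y Z; lia.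
  have Dr s : D s r.+1 = perm_eq (cycle_type s) (r.+1 :: ka) *
                         (r.+1 * (count_mem r.+1 ka).+1).
    have la_r : perm_eq (r.+1 :: la) (r.+2 :: r.+1 :: ka).
      rewrite -(perm_cons r.+1) in la_ka.
      by rewrite (permPl la_ka) -(perm_catCA [:: _] [:: _]).
    rewrite /D (permPl la_r) perm_cons perm_sym.
    case: perm_eq (@seq.permP _ (cycle_type s) (r.+1 :: ka)) => /elimT;
      rewrite ?muln0 // => -> //.
    by rewrite /= eqxx muln1 mul1n.
  under eq_bigr do rewrite Dr.
  rewrite -big_distrl -(IHn (r.+1 :: ka)) ?zee_cons ?inE //=.
  move: (\sum_s _) (zee _) (count_mem _ _) (count_mem _ _) => X Y Z W; lia.
under eq_bigr do rewrite D_la.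
rewrite -big_distrr /= factS mulnC; congr (_ * _).
by rewrite sumn_count ?la_n.
Qed.

End CycleType.

(** * Splitting the parts of a partition into two complementary subsets *)

Section Subpart.

Definition extend_set n (b : bool) (I : {set 'I_n}) : {set 'I_n.+1} :=
  [set i | if unlift ord0 i is Some j then j \in I else b].

Lemma extend_set_bij n :
  bijective (fun bI : bool * {set 'I_n} => extend_set bI.1 bI.2).
Proof.
pose split_set (A : {set 'I_n.+1}) := (ord0 \in A, [set j | lift ord0 j \in A]).
exists split_set => [[b I]|A].
  rewrite /split_set /= inE unlift_none; congr (_, _).
  by apply/setP => j; rewrite !inE liftK.
apply/setP => i; rewrite inE /=.
by case: (unliftP ord0 i) => [j|] ->; rewrite ?inE.
Qed.

Lemma setC_extend_set n b (I : {set 'I_n}) :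
  ~: extend_set b I = extend_set (~~ b) (~: I).
Proof. by apply/setP => i; rewrite !inE; case: unlift => // j; rewrite inE. Qed.

(** The enumeration is increasing, so the head position comes first; hence [subpart_extend_set] is
    an equality of lists and not only of multisets. *)
Lemma enum_extend_set n b (I : {set 'I_n}) :
  enum (extend_set b I) = nseq b ord0 ++ [seq lift ord0 i | i <- enum I].
Proof.
rewrite {1}/enum_mem -enumT enum_ordSl.
rewrite -[LHS]/(if ord0 \in extend_set b I then ord0 :: [seq _ <- _ | _]
               else [seq _ <- _ | _]).
rewrite inE unlift_none filter_map.
suff -> : [seq x <- enum 'I_n | preim (lift ord0) (mem (extend_set b I)) x] = enum I.
  by case: b.
rewrite [RHS]/enum_mem -enumT; apply: eq_filter => i.
by rewrite -[LHS]/(_ \in _) inE liftK.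
Qed.

Lemma subpart_extend_set r la b (I : {set 'I_(size la)}) :
  subpart (r :: la) (extend_set b I) = nseq b r ++ subpart la I.
Proof.
by rewrite /subpart enum_extend_set map_cat map_nseq -map_comp.
Qed.

Lemma sum_subpart_cons (F : seq nat -> seq nat -> nat) r la : (
  \sum_(I : {set 'I_(size (r :: la))})
     F (subpart (r :: la) I) (subpart (r :: la) (~: I)) =
  \sum_(I : {set 'I_(size la)})
     (F (r :: subpart la I) (subpart la (~: I)) +
      F (subpart la I) (r :: subpart la (~: I))))%N.
Proof.
rewrite (reindex _ (onW_bij _ (extend_set_bij (size la)))) /=.
rewrite -(pair_bigA _ (fun b I => F (subpart (r :: la) (extend_set b I))
  (subpart (r :: la) (~: extend_set b I)))) /= big_bool -big_split /=.
by apply: eq_bigr => I _; rewrite !setC_extend_set !subpart_extend_set.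
Qed.

Lemma subpart_nil I : subpart [::] I = [::].
Proof.
by apply: size0nil; rewrite size_map -cardE; apply: eq_card0 => -[].
Qed.

Lemma sumn_subpart la I :
  (sumn (subpart la I) + sumn (subpart la (~: I)))%N = sumn la.
Proof.
rewrite !sumnE !big_map !big_enum /= [RHS](big_nth 0%N) big_mkord.
rewrite [RHS](bigID [in I]) /=; congr (_ + _)%N.
by apply: eq_bigl => i; rewrite inE.
Qed.

Lemma subpart_gt0 la I : 0%N \notin la -> 0%N \notin subpart la I.
Proof.
by apply: contraNN => /mapP[i _ ->]; apply: mem_nth.
Qed.

Local Open Scope nat_scope.

(** Induction on [la]: the head [r] goes into [ga] or into [al], and these cases contribute
    [r * zee la] times the multiplicity of [r] in [ga] or in [al]. The multiplicities add up to that
    in [r :: la], which is the factor of [zee_cons]. If the multisets do not match, both sides are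
    zero. *)
Lemma zee_cat la al ga :
  zee la * perm_eq la (al ++ ga) = zee al * zee ga *
    \sum_(I : {set 'I_(size la)})
       perm_eq (subpart la I) ga * perm_eq (subpart la (~: I)) al.
Proof.
elim: la al ga => [|r la IHla] al ga.
  rewrite (eq_bigr (fun=> (perm_eq [::] ga * perm_eq [::] al)%N)); last first.
    by move=> I _; rewrite !subpart_nil.
  rewrite sum_nat_const -cardsT -powersetT card_powerset cardsT card_ord.
  have nilE (l : seq nat) : perm_eq [::] l = nilp l.
    by apply/idP/nilP => [/perm_size/esym/size0nil|->].
  rewrite !nilE; case: al ga => [|x al] [|y ga] //=; rewrite ?muln0 //.
  by rewrite /zee big_nil.
rewrite (sum_subpart_cons (fun x y => perm_eq x ga * perm_eq y al)).
rewrite big_split mulnDr.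
have sum_head al' ga' : zee al' * zee ga' * (\sum_(I : {set 'I_(size la)})
      perm_eq (r :: subpart la I) ga' * perm_eq (subpart la (~: I)) al') =
    r * zee la * count_mem r ga' * perm_eq (r :: la) (al' ++ ga').
  have [ga_r|ga_r] := boolP (r \in ga'); last first.
    rewrite (count_memPn ga_r) muln0 mul0n big1 ?muln0 // => I _.
    rewrite (_ : perm_eq _ ga' = false) //.
    by apply: contraNF ga_r => /perm_mem <-; rewrite mem_head.
  have ga_rem := perm_to_rem ga_r.
  under eq_bigr do rewrite (permPr ga_rem) perm_cons.
  have -> : perm_eq (r :: la) (al' ++ ga') = perm_eq la (al' ++ rem r ga').
    rewrite -(perm_cons r la); apply: (permPr _).
    by rewrite -cat1s perm_sym perm_catCA perm_cat2l perm_sym.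
  rewrite (zee_perm ga_rem) zee_cons (seq.permP ga_rem) /= eqxx add1n.
  have /(congr1 (muln (r * (count_mem r (rem r ga')).+1))) := IHla al' (rem r ga').
  move: (\sum_I _) (zee _) (zee _) (zee _) (count_mem _ _) (nat_of_bool _).
  by move=> X Y Z W T S; lia.
(* Complementing [I] reduces the second case to [sum_head] with [al] and [ga] exchanged. *)
rewrite sum_head (reindex_inj (@setC_inj _)) /=.
under eq_bigr do rewrite setCK mulnC.
rewrite [zee al * _]mulnC sum_head (permPr (permEl (perm_catC ga al))) zee_cons.
case: perm_eq (@seq.permP _ (r :: la) (al ++ ga)) => /elimT;
  rewrite ?muln0 // => /(_ isT).
by move=> /(_ (pred1 r)); rewrite count_cat /= eqxx add1n => ->; lia.
Qed.

End Subpart.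

Lemma powersums_perm (k : comNzRingType) (l1 l2 : seq nat) :
  perm_eq l1 l2 -> powersums k l1 = powersums k l2.
Proof. exact: perm_big. Qed.

Lemma powersums_cat (k : comNzRingType) (l1 l2 : seq nat) :
  powersums k (l1 ++ l2) = powersums k l1 * powersums k l2.
Proof. exact: big_cat. Qed.

Lemma powersums_partition_cat (k : comNzRingType) (l1 l2 : seq nat) :
  powersums k (partition_cat l1 l2) = powersums k l1 * powersums k l2.
Proof. by rewrite -powersums_cat; apply/powersums_perm/permEl/perm_sort. Qed.

(** * The Heisenberg product of characteristics of class functions *)

Section Heisenberg.
Variable k : fieldType.
Hypothesis char_k : [pchar k] =i pred0.
Local Notation pct s := (powersums k (cycle_type s)).
Local Notation nat_neq0 := (natr_neq0 char_k).

Definition frob n (X : 'S_n -> k) : symfun k :=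
  (n`!%:R)^-1 *: \sum_(s : 'S_n) X s *: pct s.

Section Form.
Variables (p q : nat) (X : 'S_p -> k) (Y : 'S_q -> k).

(** The characteristic of the degree [n] component, with the two characters replaced by arbitrary
    functions so as to be bilinear in them. *)
Definition heis_term (n : heis_degree p q) : symfun k :=
  let a := (val n - q)%N in let b := (p + q - val n)%N in
  let c := (val n - p)%N in
  ((a`! * b`! * c`!)%N%:R)^-1 *:
  \sum_(u : 'S_a * 'S_b * 'S_c)
    (X (to_Sp (heis_degree_p n) u) * Y (to_Sq (heis_degree_q n) u)) *:
    (pct u.1.1 * pct u.1.2 * pct u.2).

Definition heis_form := \sum_n heis_term n.
End Form.

(** Reciprocity applies because the power sum of the cycle type is a class function; its restriction
    to the parabolic subgroup is a product of three power sums, and the trace of a tensor product is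
    the product of the traces. *)
Lemma frobenius_component p q d e (V : mx_representation k [set: 'S_p] d)
    (W : mx_representation k [set: 'S_q] e) (n : heis_degree p q) :
  frobenius (heis_component n V W) =
    heis_term (fun s => \tr (V s)) (fun s => \tr (W s)) n.
Proof.
rewrite /frobenius /heis_component /ind_res_repr.
set f := to_Sn_morphism _; set rG := prod_repr _ _.
have pctJ (x g : 'S_(val n)) : pct (x ^ g)%g = pct x by rewrite cycle_type_conj.
have := sum_mxtrace_induced_inj (to_Sn_injm (heis_degree_n n)) rG pctJ.
rewrite !card_prod !card_Sn.
set N := (_ * _)%N; have N0 : N%:R != 0 :> k.
  by rewrite nat_neq0 // !muln_gt0 !fact_gt0.
have n0 : (val n)`!%:R != 0 :> k by rewrite nat_neq0 // fact_gt0.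
move/(congr1 (fun x => (N%:R * (val n)`!%:R)^-1 *: x)).
rewrite !scalerA invfM mulrAC mulVf // mul1r => ->.
rewrite mulfVK // /heis_term -/N; congr (_ *: _); apply: eq_bigr => -[[u1 u2] u3] _.
rewrite /rG /= mxtrace_prod; congr (_ *: _).
rewrite -!powersums_cat; apply: powersums_perm.
rewrite /to_Sn cycle_type_cast.
apply: perm_trans (cycle_type_perm_sum _) _; rewrite perm_cat2r.
exact: cycle_type_perm_sum.
Qed.

Section Extend.
Variables (heis : symfun k -> symfun k -> symfun k).
Hypothesis heisP : is_heisenberg_product heis.

Lemma frobD n a (f g : 'S_n -> k) :
  frob (fun x => a * f x + g x) = a *: frob f + frob g.
Proof.
rewrite /frob scalerA mulrC -scalerA -scalerDr; congr (_ *: _).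
rewrite scaler_sumr -big_split; apply: eq_bigr => s _ /=.
by rewrite scalerDl scalerA.
Qed.

Lemma heis_formDl p q a (f g : 'S_p -> k) (Y : 'S_q -> k) :
  heis_form (fun x => a * f x + g x) Y = a *: heis_form f Y + heis_form g Y.
Proof.
rewrite /heis_form scaler_sumr -big_split; apply: eq_bigr => n _ /=.
rewrite /heis_term scalerA mulrC -scalerA -scalerDr; congr (_ *: _).
rewrite scaler_sumr -big_split; apply: eq_bigr => s _ /=.
by rewrite mulrDl scalerDl scalerA mulrA.
Qed.

Lemma heis_formDr p q a (X : 'S_p -> k) (f g : 'S_q -> k) :
  heis_form X (fun x => a * f x + g x) = a *: heis_form X f + heis_form X g.
Proof.
rewrite /heis_form scaler_sumr -big_split; apply: eq_bigr => n _ /=.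
rewrite /heis_term scalerA mulrC -scalerA -scalerDr; congr (_ *: _).
rewrite scaler_sumr -big_split; apply: eq_bigr => s _ /=.
by rewrite mulrDr scalerDl scalerA mulrCA.
Qed.

Lemma eq_frob n (f g : 'S_n -> k) : f =1 g -> frob f = frob g.
Proof. by move=> fg; congr (_ *: _); apply: eq_bigr => s _; rewrite fg. Qed.

Lemma eq_heis_form p q (X X' : 'S_p -> k) (Y Y' : 'S_q -> k) :
  X =1 X' -> Y =1 Y' -> heis_form X Y = heis_form X' Y'.
Proof.
move=> eX eY; apply: eq_bigr => n _; congr (_ *: _).
by apply: eq_bigr => u _; rewrite eX eY.
Qed.

Lemma frob0 n : frob (fun _ : 'S_n => 0) = 0.
Proof. by rewrite /frob big1 ?scaler0 // => s _; rewrite scale0r. Qed.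

Lemma heis_form0l p q (Y : 'S_q -> k) : heis_form (fun _ : 'S_p => 0) Y = 0.
Proof.
rewrite /heis_form big1 // => n _; rewrite /heis_term big1 ?scaler0 // => s _.
by rewrite mul0r scale0r.
Qed.

Lemma heis_form0r p q (X : 'S_p -> k) : heis_form X (fun _ : 'S_q => 0) = 0.
Proof.
rewrite /heis_form big1 // => n _; rewrite /heis_term big1 ?scaler0 // => s _.
by rewrite mulr0 scale0r.
Qed.

(** Both sides are bilinear and agree on characters, so [cyclic_class_fun_ind] applies first in [X]
    and then in [Y]. *)
Lemma heis_frob p q (X : {ffun 'S_p -> k}) (Y : {ffun 'S_q -> k}) :
  cyclic_class_fun X -> cyclic_class_fun Y ->
  heis (frob X) (frob Y) = heis_form X Y.
Proof.
case: heisP => lin_l lin_r heis_V cX cY.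
(* Linearity is given as compatibility with [a *: u + v]; taking [a = -1] and [u = v = 0] yields the
   value at zero. *)
have heis0l g : heis 0 g = 0.
  by have := lin_l g (-1) 0 0; rewrite scaler0 add0r scaleN1r addNr.
have heis0r g : heis g 0 = 0.
  by have := lin_r g (-1) 0 0; rewrite scaler0 add0r scaleN1r addNr.
move: X cX; apply: (cyclic_class_fun_ind char_k) => [|a f g IHf IHg|d V].
- rewrite (eq_frob (ffunE _)) (eq_heis_form (ffunE _) (frefl Y)).
  by rewrite frob0 heis0l heis_form0l.
- rewrite (eq_frob (ffunE _)) (eq_heis_form (ffunE _) (frefl Y)) frobD heis_formDl.
  by rewrite lin_l IHf IHg.
move: Y cY; apply: (cyclic_class_fun_ind char_k) => [|a f g IHf IHg|e W].
- rewrite (eq_frob (g := fun=> 0) (ffunE _)) frob0 heis0r.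
  by rewrite (eq_heis_form (frefl _) (ffunE _)) heis_form0r.
- rewrite [in LHS](eq_frob (ffunE (fun x => a * f x + g x))).
  rewrite (eq_heis_form (frefl _) (ffunE _)) frobD heis_formDr.
  by rewrite lin_r IHf IHg.
rewrite (eq_frob (ffunE (fun s => \tr (V s)))).
rewrite (eq_frob (ffunE (fun s => \tr (W s)))).
rewrite (eq_heis_form (ffunE _) (ffunE _)).
rewrite -[frob _]/(frobenius V) -[frob _]/(frobenius W).
by rewrite heis_V; apply: eq_bigr => n _; apply: frobenius_component.
Qed.

End Extend.

(** * Evaluation on scaled indicators of cycle types *)

Definition type_indicator n (la : seq nat) : {ffun 'S_n -> k} :=
  [ffun s => (zee la * perm_eq la (cycle_type s))%:R].

Lemma type_indicator_class n la : cyclic_class_fun (type_indicator n la).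
Proof.
move=> x y g; rewrite -cycleJ !ffunE => /cycle_type_cycle ->.
by rewrite cycle_type_conj.
Qed.

(** The factor [zee la] cancels against the [n! / zee la] permutations of type [la]. The vanishing
    in a wrong degree later singles out one [n] for each pair of subsets. *)
Lemma frob_type_indicator n la : 0%N \notin la ->
  frob (type_indicator n la) = (sumn la == n)%:R *: powersums k la.
Proof.
move=> la0.
have -> : frob (type_indicator n la) = ((n`!%:R)^-1 *
    (\sum_(s : 'S_n) perm_eq (cycle_type s) la * zee la)%N%:R) *: powersums k la.
  rewrite /frob -scalerA natr_sum scaler_suml; congr (_ *: _).
  apply: eq_bigr => s _; rewrite ffunE perm_sym mulnC.
  by case: (boolP (perm_eq _ _)) => [/powersums_perm-> //|_]; rewrite mul0n !scale0r.
congr (_ *: _); rewrite -big_distrl /=; case: eqP => [la_n|la_n].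
  by rewrite card_cycle_type // mulVf // nat_neq0 // fact_gt0.
rewrite big1 ?mulr0 // => s _; case: (boolP (perm_eq _ _)) => // e.
by case: la_n; rewrite -(perm_sumn e) sumn_cycle_type.
Qed.

Lemma frob_mul3 a b c (X : 'S_a -> k) (Y : 'S_b -> k) (Z : 'S_c -> k) :
  ((a`! * b`! * c`!)%N%:R)^-1 *: \sum_(u : 'S_a * 'S_b * 'S_c)
     (X u.1.1 * Y u.1.2 * Z u.2) *: (pct u.1.1 * pct u.1.2 * pct u.2) =
  frob X * frob Y * frob Z.
Proof.
rewrite /frob -!scalerAl -!scalerAr -scalerAl !scalerA !natrM !invfM.
congr (_ *: _); first by ring.
rewrite big_distrlr /= (pair_bigA _ (fun s t => X s *: pct s * (Y t *: pct t))) /=.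
rewrite big_distrlr (pair_bigA _ (fun u t =>
  X u.1 *: pct u.1 * (Y u.2 *: pct u.2) * (Z t *: pct t))) /=.
apply: eq_bigr => u _.
by rewrite -!scalerAl -!scalerAr -!scalerAl !scalerA; congr (_ *: _); ring.
Qed.

(** By [zee_cat] each indicator expands over subsets of parts. The middle permutation is shared, so
    both chosen subsets have its type [ga]; of the two factors [zee ga], one goes into its indicator
    and the other is the coefficient. *)
Lemma type_indicator_mul a b c p q (ab : (a + b)%N = p) (bc : (b + c)%N = q)
    la mu (u : 'S_a * 'S_b * 'S_c) :
  type_indicator p la (to_Sp ab u) * type_indicator q mu (to_Sq bc u) =
  \sum_(I : {set 'I_(size la)})
    \sum_(J : {set 'I_(size mu)} | perm_eq (subpart la I) (subpart mu J))
      (zee (subpart la I))%:R *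
        (type_indicator a (subpart la (~: I)) u.1.1 *
         type_indicator b (subpart la I) u.1.2 *
         type_indicator c (subpart mu (~: J)) u.2).
Proof.
rewrite !ffunE /to_Sp /to_Sq !cycle_type_cast.
rewrite !(permPr (cycle_type_perm_sum _)) /=.
(* The shared middle type must come second in both concatenations, where [zee_cat] matches it with
   the chosen subset. *)
rewrite (permPr (permEl (perm_catC (cycle_type u.1.2) _))).
rewrite !zee_cat -natrM mulnACA big_distrlr big_distrr natr_sum /=.
apply: eq_bigr => I _; rewrite big_distrr natr_sum big_mkcond [RHS]big_mkcond /=.
apply: eq_bigr => J _; rewrite !ffunE -!natrM.
have [Iu|] := boolP (perm_eq (subpart la I) (cycle_type u.1.2)); last first.
  by rewrite !(mul0n, muln0); case: ifP.
rewrite (permPl Iu) (perm_sym (cycle_type u.1.2)).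
case: (boolP (perm_eq _ (cycle_type u.1.2))) => [Ju|]; last first.
  by rewrite !(mul0n, muln0).
rewrite (zee_perm Iu).
case: (boolP (perm_eq _ (cycle_type u.1.1))) => [/zee_perm->|]; last first.
  by rewrite !(mul0n, muln0).
case: (boolP (perm_eq _ (cycle_type u.2))) => [/zee_perm->|]; last first.
  by rewrite !(mul0n, muln0).
rewrite /= !muln1; congr _%:R; move: (zee _) (zee _) (zee _) => x y z; lia.
Qed.

Lemma heis_term_type_indicator p q la mu (n : heis_degree p q) :
  heis_term (type_indicator p la) (type_indicator q mu) n =
  \sum_(I : {set 'I_(size la)})
    \sum_(J : {set 'I_(size mu)} | perm_eq (subpart la I) (subpart mu J))
      (zee (subpart la I))%:R *:
        (frob (type_indicator (val n - q) (subpart la (~: I))) *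
         frob (type_indicator (p + q - val n) (subpart la I)) *
         frob (type_indicator (val n - p) (subpart mu (~: J)))).
Proof.
rewrite /heis_term; under eq_bigr do rewrite type_indicator_mul scaler_suml.
rewrite exchange_big scaler_sumr; apply: eq_bigr => I _.
under eq_bigr do rewrite scaler_suml.
rewrite exchange_big scaler_sumr; apply: eq_bigr => J _.
rewrite -frob_mul3 scalerA mulrC -scalerA; congr (_ *: _).
by rewrite scaler_sumr; apply: eq_bigr => u _; rewrite scalerA.
Qed.

Lemma heis_form_type_indicator p q (la mu : seq nat) :
    0%N \notin la -> 0%N \notin mu ->
    sumn la = p -> sumn mu = q ->
  heis_form (type_indicator p la) (type_indicator q mu) =
    \sum_(I : {set 'I_(size la)})
      \sum_(J : {set 'I_(size mu)} | perm_eq (subpart la I) (subpart mu J))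
        (zee (subpart la I))%:R *: (powersums k (subpart la (~: I)) *
            powersums k (subpart la I) * powersums k (subpart mu (~: J))).
Proof.
move=> la0 mu0 la_p mu_q; rewrite /heis_form.
under eq_bigr do rewrite heis_term_type_indicator.
rewrite exchange_big; apply: eq_bigr => I _.
rewrite exchange_big; apply: eq_bigr => J IJ; rewrite -scaler_sumr; congr (_ *: _).
under eq_bigr do rewrite !frob_type_indicator ?subpart_gt0 //.
have := sumn_subpart I; rewrite la_p.
have := sumn_subpart J; rewrite mu_q -(perm_sumn IJ).
set al := sumn (subpart la (~: I)); set ga := sumn (subpart la I).
set be := sumn (subpart mu (~: J)) => q_def p_def.
(* The only degree in which all three factors survive is the total size of [al], [ga] and [be]. *)
have m_lt : (al + ga + be < (p + q).+1)%N by lia.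
have m_ge : (maxn p q <= Ordinal m_lt)%N by rewrite /=; lia.
rewrite (bigD1 (exist _ (Ordinal m_lt) m_ge : heis_degree p q)) //=.
rewrite big1 ?addr0 => [|n].
  have -> : (al == al + ga + be - q)%N by apply/eqP; lia.
  have -> : (ga == p + q - (al + ga + be))%N by apply/eqP; lia.
  have -> : (be == al + ga + be - p)%N by apply/eqP; lia.
  by rewrite !scale1r.
(* In any other degree the first factor already vanishes: [n] is at least [q], which is [ga + be],
   so [n - q = al] determines [n]. *)
rewrite -!val_eqE /= => n_neq; case: eqP => [al_n|]; last by rewrite scale0r !mul0r.
case/eqP: n_neq; case: n al_n => -[m /= m_lt'] /= m_ge'; lia.
Qed.

End Heisenberg.

Theorem theorem3p4 (k : fieldType) (char_k : [pchar k] =i pred0)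
    (heis : symfun k -> symfun k -> symfun k)
    (heisP : is_heisenberg_product heis)
    (la mu : seq nat) (la_part : is_partition la) (mu_part : is_partition mu) :
  heis (powersums k la) (powersums k mu) =
    \sum_(I : {set 'I_(size la)})
      \sum_(J : {set 'I_(size mu)} | perm_eq (subpart la I) (subpart mu J))
        let al := subpart la (~: I) in
        let ga := subpart la I in
        let be := subpart mu (~: J) in
        (zee ga)%:R *: powersums k (partition_cat (partition_cat al ga) be).
Proof.
case/andP: la_part mu_part => _ la0 /andP[_ mu0].
have frobE nu : 0%N \notin nu ->
  powersums k nu = frob (type_indicator k (sumn nu) nu).
  by move=> nu0; rewrite frob_type_indicator // eqxx scale1r.
rewrite (frobE la) // (frobE mu) // heis_frob //; try exact: type_indicator_class.
rewrite heis_form_type_indicator //.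
apply: eq_bigr => I _; apply: eq_bigr => J _.
by rewrite /= !powersums_partition_cat.
Qed.
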